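(* Let $\phi:Q\to Q'$ be a quandle homomorphism and let $A$ be an abelian $Q'$-quandle. Consider $\operatorname{Der}_\phi(Q,A)$ and $\operatorname{Hom}_{Q'}(\mathcal{A}_\phi,A)$ as quandles with the operations given in the context. Then: (1) If $A$ is commutative, then $\operatorname{Der}_\phi(Q,A)$ and $\operatorname{Hom}_{Q'}(\mathcal{A}_\phi,A)$ are commutative. (2) If $A$ is involutary, then $\operatorname{Der}_\phi(Q,A)$ and $\operatorname{Hom}_{Q'}(\mathcal{A}_\phi,A)$ are involutary. (3) If $A$ is flat, then $\operatorname{Der}_\phi(Q,A)$ and $\operatorname{Hom}_{Q'}(\mathcal{A}_\phi,A)$ are flat.
   Context: A quandle is a non-empty set $Q$ with a binary operation $*$ such that (Q1) $q*q=q$ for all $q$; (Q2) for all $q_1,q_2\in Q$ there is a unique $q\in Q$ with $q_2=q*q_1$; (Q3) $(q_1*q_2)*q_3=(q_1*q_3)*(q_2*q_3)$ for all $q_1,q_2,q_3$. A quandle homomorphism is a map $f$ with $f(q_1*q_2)=f(q_1)*f(q_2)$. For $q\in Q$ let $S_q:Q\to Q$, $S_q(p)=p*q$ (an automorphism of $Q$). A quandle $A$ is abelian if $(x*y)*(z*w)=(x*z)*(y*w)$ for all $x,y,z,w\in A$; commutative if $p*q=q*p$ for all $p,q$; involutary if $S_q^2=\operatorname{id}$ for all $q$; flat if the group $\langle S_p\circ S_q\mid p,q\rangle$ is abelian. The associated group $\operatorname{As}(Q)$ is the group generated by $\{e_q \mid q\in Q\}$ modulo the relations $e_{q_1*q_2}=e_{q_2}e_{q_1}e_{q_2}^{-1}$.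 A quandle homomorphism $\phi:Q\to Q'$ induces a group homomorphism $\phi:\operatorname{As}(Q)\to\operatorname{As}(Q')$, $\phi(e_q)=e_{\phi(q)}$. A quandle $A$ is a $Q'$-quandle if it is equipped with a (left) action $(g,a)\mapsto g\cdot a$ of $\operatorname{As}(Q')$ on $A$ by quandle automorphisms. A $Q'$-homomorphism between $Q'$-quandles is a quandle homomorphism commuting with the actions of $\operatorname{As}(Q')$; $\operatorname{Hom}_{Q'}(A_1,A_2)$ is the set of these. Given $\phi:Q\to Q'$ and a $Q'$-quandle $A$, a derivation is a map $\partial:Q\to A$ with $\partial(q_1*q_2)=\partial(q_1)*\big(\phi(e_{q_1})\cdot\partial(q_2)\big)$ for all $q_1,q_2\in Q$; $\operatorname{Der}_\phi(Q,A)$ is the set of all derivations. When $A$ is abelian it carries the operation $(f*g)(q)=f(q)*g(q)$. The derived quandle $\mathcal{A}_\phi$ of $\phi$ is the quandle with generating set $\operatorname{As}(Q')\times Q$ and relations $(g,q_1*q_2)=(g,q_1)*(g\phi(e_{q_1}),q_2)$ for $q_1,q_2\in Q$, $g\in\operatorname{As}(Q')$; it is a $Q'$-quandle via $g'\cdot(g,q)=(g'g,q)$, and $\partial(q)=(1,q)$ is a derivation $Q\to \mathcal{A}_\phi$ which is universal: every derivation $\partial':Q\to A$ to a $Q'$-quandle factors as $\partial'=\lambda\circ\partial$ for a unique $Q'$-homomorphism $\lambda:\mathcal{A}_\phi\to A$. When $A$ is abelian, $\operatorname{Hom}_{Q'}(\mathcal{A}_\phi,A)$ carries the operation determined on generators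 by $(\lambda_1*\lambda_2)((g,q))=\lambda_1((g,q))*\lambda_2((g,q))$. These sets are quandles when non-empty; if they are empty the assertions are understood to hold vacuously. *)

(* Defs.v *)
From HB Require Import structures.
From mathcomp Require Import all_boot boolp.

Set Implicit Arguments.
Unset Strict Implicit.
Unset Printing Implicit Defensive.

Local Open Scope group_scope.
Local Open Scope quotient_scope.

Declare Scope quandle_scope.
Delimit Scope quandle_scope with Qd.
Reserved Notation "x <* y" (at level 40, left associativity).

HB.mixin Record isQuandle T of Choice T := {
  qop : T -> T -> T;
  qop_idem : forall q : T, qop q q = q;
  qop_divP : forall q1 q2 : T, exists! q : T, q2 = qop q q1;
  qop_distr : forall q1 q2 q3 : T,
    qop (qop q1 q2) q3 = qop (qop q1 q3) (qop q2 q3);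
  quandle_inhabited : inhabited T
}.

#[short(type="quandleType")]
HB.structure Definition Quandle := {T of isQuandle T & Choice T}.

Notation "x <* y" := (qop x y) : quandle_scope.
Local Open Scope quandle_scope.

Record quandle_hom (Q1 Q2 : quandleType) := QuandleHom {
  quandle_hom_fun :> Q1 -> Q2;
  quandle_homM : {morph quandle_hom_fun : p q / p <* q}
}.

Section Properties.
Variable Q : quandleType.
Implicit Types p q u v x y z w : Q.

Definition qtrans q : Q -> Q := fun p => p <* q.

Definition abelian_quandle :=
  forall x y z w, (x <* y) <* (z <* w) = (x <* z) <* (y <* w).

Definition commutative_quandle := forall p q, p <* q = q <* p.

Definition involutary_quandle := forall q, qtrans q \o qtrans q = id.

(* The subgroup generated by the maps S_p \o S_q in the group of bijections of
   Q, seen as a set of maps Q -> Q. *)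
Inductive flat_group : (Q -> Q) -> Prop :=
| flat_group_gen p q : flat_group (qtrans p \o qtrans q)
| flat_group_id : flat_group id
| flat_group_comp f g : flat_group f -> flat_group g -> flat_group (f \o g)
| flat_group_inv f g :
    flat_group f -> cancel f g -> cancel g f -> flat_group g.

Definition flat_quandle :=
  forall f g, flat_group f -> flat_group g -> f \o g = g \o f.

(* qdiv u v is the unique q with u = q <* v. *)
Definition qdiv u v : Q := sval (cid (qop_divP v u)).

Lemma qdivK u v : qdiv u v <* v = u.
Proof. by rewrite /qdiv; case: cid => q [/= <-]. Qed.

Lemma qop_inj v u1 u2 : u1 <* v = u2 <* v -> u1 = u2.
Proof.
by have [q [_ qU]] := qop_divP v (u2 <* v) => e; rewrite -(qU u1) ?e// (qU u2).
Qed.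

Lemma qopK u v : qdiv (u <* v) v = u.
Proof. by apply: (@qop_inj v); rewrite qdivK. Qed.

End Properties.

Lemma qhom_div (Q1 Q2 : quandleType) (f : Q1 -> Q2) :
  {morph f : p q / p <* q} -> {morph f : p q / qdiv p q}.
Proof. by move=> fM p q; apply: (@qop_inj _ (f q)); rewrite -fM !qdivK. Qed.

Section GroupPresentation.
Variable X : Type.

Inductive gterm :=
| GGen of X
| GOne
| GMul of gterm & gterm
| GInv of gterm.

HB.instance Definition _ := gen_eqMixin gterm.
HB.instance Definition _ := gen_choiceMixin gterm.

Variable R : gterm -> gterm -> Prop.

Inductive gcongr : gterm -> gterm -> Prop :=
| gc_rel u v : R u v -> gcongr u v
| gc_refl u : gcongr u u
| gc_sym u v : gcongr u v -> gcongr v u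
| gc_trans u v w : gcongr u v -> gcongr v w -> gcongr u w
| gc_mul u u' v v' :
    gcongr u u' -> gcongr v v' -> gcongr (GMul u v) (GMul u' v')
| gc_inv u u' : gcongr u u' -> gcongr (GInv u) (GInv u')
| gc_mulA u v w : gcongr (GMul u (GMul v w)) (GMul (GMul u v) w)
| gc_mul1 u : gcongr (GMul GOne u) u
| gc_mulr1 u : gcongr (GMul u GOne) u
| gc_mulV u : gcongr (GMul (GInv u) u) GOne
| gc_mulrV u : gcongr (GMul u (GInv u)) GOne.

Definition gcongrb : rel gterm := fun u v => `[< gcongr u v >].

Lemma gcongrb_refl : reflexive gcongrb.
Proof. by move=> u; apply/asboolP/gc_refl. Qed.

Lemma gcongrb_sym : symmetric gcongrb.
Proof. by move=> u v; apply/asboolP/asboolP => /gc_sym. Qed.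

Lemma gcongrb_trans : transitive gcongrb.
Proof.
by move=> v u w /asboolP uv /asboolP vw; apply/asboolP/(gc_trans uv vw).
Qed.

Canonical gcongr_equiv := EquivRel gcongrb gcongrb_refl gcongrb_sym gcongrb_trans.

Definition pgroup_of := {eq_quot gcongrb}.
HB.instance Definition _ := Choice.on pgroup_of.
HB.instance Definition _ := EqQuotient.on pgroup_of.

Lemma pgroup_eqP (u v : gterm) : \pi_pgroup_of u = \pi_pgroup_of v <-> gcongr u v.
Proof. by split=> [/eqmodP/asboolP//|uv]; apply/eqmodP/asboolP. Qed.

Lemma gcongr_repr (u : gterm) : gcongr (repr (\pi_pgroup_of u)) u.
Proof. by apply/pgroup_eqP; rewrite reprK. Qed.

Definition pgroup_gen (x : X) : pgroup_of := \pi_pgroup_of (GGen x).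
Let one : pgroup_of := \pi_pgroup_of GOne.
Let mul (a b : pgroup_of) : pgroup_of := \pi_pgroup_of (GMul (repr a) (repr b)).
Let inv (a : pgroup_of) : pgroup_of := \pi_pgroup_of (GInv (repr a)).

Let piM u v : mul (\pi_pgroup_of u) (\pi_pgroup_of v) = \pi_pgroup_of (GMul u v).
Proof. by apply/pgroup_eqP/gc_mul; exact: gcongr_repr. Qed.

Let piV u : inv (\pi_pgroup_of u) = \pi_pgroup_of (GInv u).
Proof. by apply/pgroup_eqP/gc_inv; exact: gcongr_repr. Qed.

Let mulA : associative mul.
Proof.
elim/quotW=> a; elim/quotW=> b; elim/quotW=> c; rewrite (piM b) (piM a b) 2!piM.
exact/pgroup_eqP/gc_mulA.
Qed.

Let mul1 : left_id one mul.
Proof. by elim/quotW=> a; rewrite !piM; exact/pgroup_eqP/gc_mul1. Qed.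

Let mulr1 : right_id one mul.
Proof. by elim/quotW=> a; rewrite !piM; exact/pgroup_eqP/gc_mulr1. Qed.

Let mulV : left_inverse one inv mul.
Proof. by elim/quotW=> a; rewrite piV piM; exact/pgroup_eqP/gc_mulV. Qed.

Let mulrV : right_inverse one inv mul.
Proof. by elim/quotW=> a; rewrite piV piM; exact/pgroup_eqP/gc_mulrV. Qed.

HB.instance Definition _ := isGroup.Build pgroup_of mulA mul1 mulr1 mulV mulrV.

Lemma pgroup_piM (u v : gterm) :
  (\pi_pgroup_of u * \pi_pgroup_of v)%g = \pi_pgroup_of (GMul u v).
Proof. exact: piM. Qed.

Lemma pgroup_piV (u : gterm) : (\pi_pgroup_of u)^-1 = \pi_pgroup_of (GInv u).
Proof. exact: piV. Qed.

End GroupPresentation.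

Section GroupLift.
Variables (X : Type) (G : groupType) (f : X -> G).

Fixpoint geval (u : gterm X) : G :=
  match u with
  | GGen x => f x
  | GOne => 1
  | GMul u v => geval u * geval v
  | GInv u => (geval u)^-1
  end.

Variable R : gterm X -> gterm X -> Prop.
Hypothesis fR : forall u v, R u v -> geval u = geval v.

Lemma geval_congr u v : gcongr R u v -> geval u = geval v.
Proof.
elim=> {u v} //=; first by move=> u v w _ -> _ ->.
- by move=> u u' v v' _ -> _ ->.
- by move=> u u' _ ->.
- by move=> u v w; rewrite mulgA.
- by move=> u; rewrite mul1g.
- by move=> u; rewrite mulg1.
- by move=> u; rewrite mulVg.
- by move=> u; rewrite mulgV.
Qed.

Definition pgroup_lift of (forall u v, R u v -> geval u = geval v) :
  pgroup_of R -> G := fun a => geval (repr a).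

Lemma pgroup_liftE u : pgroup_lift fR (\pi_(pgroup_of R) u) = geval u.
Proof. exact/geval_congr/gcongr_repr. Qed.

Lemma pgroup_lift_gen x : pgroup_lift fR (pgroup_gen R x) = f x.
Proof. exact: pgroup_liftE. Qed.

Lemma pgroup_liftM : {morph pgroup_lift fR : a b / a * b}.
Proof.
by elim/quotW=> a; elim/quotW=> b; rewrite pgroup_piM !pgroup_liftE.
Qed.

End GroupLift.

Section AssociatedGroup.

Inductive as_rel (Q : quandleType) : gterm Q -> gterm Q -> Prop :=
| AsRel q1 q2 : as_rel (GGen (q1 <* q2))
    (GMul (GMul (GGen q2) (GGen q1)) (GInv (GGen q2))).

Definition As (Q : quandleType) := pgroup_of (@as_rel Q).
HB.instance Definition _ Q := Group.on (As Q).

Definition as_gen (Q : quandleType) (q : Q) : As Q := pgroup_gen (@as_rel Q) q.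

Lemma as_genJ (Q : quandleType) (q1 q2 : Q) :
  as_gen (q1 <* q2) = as_gen q2 * as_gen q1 * (as_gen q2)^-1.
Proof.
transitivity (\pi_(pgroup_of (@as_rel Q))
                (GMul (GMul (GGen q2) (GGen q1)) (GInv (GGen q2)))).
  exact/pgroup_eqP/gc_rel.
by rewrite -!pgroup_piM -pgroup_piV.
Qed.

Variables (Q Q' : quandleType) (phi : quandle_hom Q Q').

Lemma as_map_rel u v :
  as_rel u v -> geval (@as_gen Q' \o phi) u = geval (@as_gen Q' \o phi) v.
Proof. by case=> q1 q2 /=; rewrite quandle_homM as_genJ. Qed.

Definition as_map : As Q -> As Q' := pgroup_lift as_map_rel.

Lemma as_map_gen q : as_map (as_gen q) = as_gen (phi q).
Proof. exact: pgroup_lift_gen. Qed.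

Lemma as_mapM : {morph as_map : a b / a * b}.
Proof. exact: pgroup_liftM. Qed.

End AssociatedGroup.

HB.mixin Record isActedQuandle (Q' : quandleType) A of Quandle A := {
  qact : As Q' -> A -> A;
  qact1 : forall a, qact 1 a = a;
  qactM : forall g h a, qact (g * h) a = qact g (qact h a);
  qact_op : forall g, {morph qact g : a b / a <* b}
}.

#[short(type="actedQuandleType")]
HB.structure Definition ActedQuandle (Q' : quandleType) :=
  {A of isActedQuandle Q' A & Quandle A}.

Record acted_hom (Q' : quandleType) (A1 A2 : actedQuandleType Q') := ActedHom {
  acted_hom_fun :> A1 -> A2;
  acted_homM : {morph acted_hom_fun : a b / a <* b};
  acted_homJ : forall (g : As Q') a,
    acted_hom_fun (qact g a) = qact g (acted_hom_fun a)
}.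

Lemma acted_hom_eq (Q' : quandleType) (A1 A2 : actedQuandleType Q')
  (f g : acted_hom A1 A2) : f =1 g -> f = g.
Proof.
case: f g => [f fM fJ] [g gM gJ] /= /funext fg.
by rewrite fg in fM fJ *; congr ActedHom; exact: Prop_irrelevance.
Qed.

Section QuandlePresentation.
Variable X : Type.

(* QDiv u v stands for the unique w with u = w <* v given by axiom (Q2). *)
Inductive qterm :=
| QGen of X
| QOp of qterm & qterm
| QDiv of qterm & qterm.

HB.instance Definition _ := gen_eqMixin qterm.
HB.instance Definition _ := gen_choiceMixin qterm.

Variable R : qterm -> qterm -> Prop.

Inductive qcongr : qterm -> qterm -> Prop :=
| qc_rel u v : R u v -> qcongr u v
| qc_refl u : qcongr u u
| qc_sym u v : qcongr u v -> qcongr v u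
| qc_trans u v w : qcongr u v -> qcongr v w -> qcongr u w
| qc_op u u' v v' :
    qcongr u u' -> qcongr v v' -> qcongr (QOp u v) (QOp u' v')
| qc_div u u' v v' :
    qcongr u u' -> qcongr v v' -> qcongr (QDiv u v) (QDiv u' v')
| qc_idem u : qcongr (QOp u u) u
| qc_divK u v : qcongr (QOp (QDiv u v) v) u
| qc_opK u v : qcongr (QDiv (QOp u v) v) u
| qc_distr u v w :
    qcongr (QOp (QOp u v) w) (QOp (QOp u w) (QOp v w)).

Definition qcongrb : rel qterm := fun u v => `[< qcongr u v >].

Lemma qcongrb_refl : reflexive qcongrb.
Proof. by move=> u; apply/asboolP/qc_refl. Qed.

Lemma qcongrb_sym : symmetric qcongrb.
Proof. by move=> u v; apply/asboolP/asboolP => /qc_sym. Qed.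

Lemma qcongrb_trans : transitive qcongrb.
Proof.
by move=> v u w /asboolP uv /asboolP vw; apply/asboolP/(qc_trans uv vw).
Qed.

Canonical qcongr_equiv := EquivRel qcongrb qcongrb_refl qcongrb_sym qcongrb_trans.

(* The generating set has to be non-empty for the result to be a quandle. *)
Definition pquandle_of of inhabited X := {eq_quot qcongrb}.

Variable X0 : inhabited X.
Local Notation PQ := (pquandle_of X0).
HB.instance Definition _ := Choice.on PQ.
HB.instance Definition _ := EqQuotient.on PQ.

Lemma pquandle_eqP (u v : qterm) : \pi_PQ u = \pi_PQ v <-> qcongr u v.
Proof. by split=> [/eqmodP/asboolP//|uv]; apply/eqmodP/asboolP. Qed.

Lemma qcongr_repr (u : qterm) : qcongr (repr (\pi_PQ u)) u.
Proof. by apply/pquandle_eqP; rewrite reprK. Qed.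

Definition pquandle_gen (x : X) : PQ := \pi_PQ (QGen x).
Let op (a b : PQ) : PQ := \pi_PQ (QOp (repr a) (repr b)).

Let pi_op u v : op (\pi_PQ u) (\pi_PQ v) = \pi_PQ (QOp u v).
Proof. by apply/pquandle_eqP/qc_op; exact: qcongr_repr. Qed.

Let op_idem a : op a a = a.
Proof. by elim/quotW: a => a; rewrite pi_op; exact/pquandle_eqP/qc_idem. Qed.

Let op_divP a b : exists! q, b = op q a.
Proof.
elim/quotW: a => a; elim/quotW: b => b; exists (\pi_PQ (QDiv b a)); split.
  by rewrite pi_op; exact/pquandle_eqP/qc_sym/qc_divK.
elim/quotW=> c; rewrite pi_op => /pquandle_eqP bca.
apply/pquandle_eqP/(@qc_trans _ (QDiv (QOp c a) a)); last exact: qc_opK.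
by apply: qc_div => //; exact: qc_refl.
Qed.

Let op_distr a b c : op (op a b) c = op (op a c) (op b c).
Proof.
elim/quotW: a => a; elim/quotW: b => b; elim/quotW: c => c.
rewrite (pi_op a b) (pi_op a c) (pi_op b c) 2!pi_op.
exact/pquandle_eqP/qc_distr.
Qed.

Let op_inhabited : inhabited PQ.
Proof. by case: X0 => x; exact: (inhabits (pquandle_gen x)). Qed.

HB.instance Definition _ :=
  isQuandle.Build PQ op_idem op_divP op_distr op_inhabited.

Lemma pquandle_piM (u v : qterm) : \pi_PQ u <* \pi_PQ v = \pi_PQ (QOp u v).
Proof. exact: pi_op. Qed.

Lemma pquandle_pi_div (u v : qterm) :
  qdiv (\pi_PQ u) (\pi_PQ v) = \pi_PQ (QDiv u v).
Proof.
apply: (@qop_inj _ (\pi_PQ v)); rewrite qdivK pquandle_piM.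
exact/pquandle_eqP/qc_sym/qc_divK.
Qed.

End QuandlePresentation.

Section QuandleLift.
Variables (X : Type) (Q : quandleType) (f : X -> Q).

Fixpoint qeval (u : qterm X) : Q :=
  match u with
  | QGen x => f x
  | QOp u v => qeval u <* qeval v
  | QDiv u v => qdiv (qeval u) (qeval v)
  end.

Variables (R : qterm X -> qterm X -> Prop) (X0 : inhabited X).
Local Notation PQ := (pquandle_of R X0).
Hypothesis fR : forall u v, R u v -> qeval u = qeval v.

Lemma qeval_congr u v : qcongr R u v -> qeval u = qeval v.
Proof.
elim=> {u v} //=; first by move=> u v w _ -> _ ->.
- by move=> u u' v v' _ -> _ ->.
- by move=> u u' v v' _ -> _ ->.
- by move=> u; rewrite qop_idem.
- by move=> u v; rewrite qdivK.
- by move=> u v; rewrite qopK.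
- by move=> u v w; rewrite qop_distr.
Qed.

Definition pquandle_lift of (forall u v, R u v -> qeval u = qeval v) :
  PQ -> Q := fun a => qeval (repr a).

Lemma pquandle_liftE u : pquandle_lift fR (\pi_PQ u) = qeval u.
Proof. exact/qeval_congr/qcongr_repr. Qed.

Lemma pquandle_lift_gen x : pquandle_lift fR (pquandle_gen R X0 x) = f x.
Proof. exact: pquandle_liftE. Qed.

Lemma pquandle_liftM : {morph pquandle_lift fR : a b / a <* b}.
Proof.
by elim/quotW=> a; elim/quotW=> b; rewrite pquandle_piM !pquandle_liftE.
Qed.

Lemma pquandle_hom_ext (h k : PQ -> Q) :
  {morph h : a b / a <* b} -> {morph k : a b / a <* b} ->
  (forall x, h (pquandle_gen R X0 x) = k (pquandle_gen R X0 x)) -> h =1 k.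
Proof.
move=> hM kM hk; elim/quotW; elim=> [x|u IHu v IHv|u IHu v IHv]; first exact: hk.
  by rewrite -pquandle_piM hM kM IHu IHv.
by rewrite -pquandle_pi_div (qhom_div hM) (qhom_div kM) IHu IHv.
Qed.

End QuandleLift.

Section Derivations.
Variables (Q Q' : quandleType) (phi : quandle_hom Q Q').

Section Der.
Variable A : actedQuandleType Q'.

Definition is_derivation (d : Q -> A) :=
  forall q1 q2, d (q1 <* q2) = d q1 <* qact (as_map phi (as_gen q1)) (d q2).

Record Der := MkDer { der_fun :> Q -> A; der_funP : is_derivation der_fun }.

HB.instance Definition _ := gen_eqMixin Der.
HB.instance Definition _ := gen_choiceMixin Der.

Lemma der_eq (f g : Der) : f =1 g -> f = g.
Proof.
case: f g => [f fP] [g gP] /= /funext fg.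
by rewrite fg in fP *; congr MkDer; exact: Prop_irrelevance.
Qed.

Hypothesis abA : abelian_quandle A.

Lemma der_op_subproof (f g : Der) : is_derivation (fun q => f q <* g q).
Proof. by move=> q1 q2; rewrite !der_funP abA qact_op. Qed.

Definition der_op (f g : Der) : Der := MkDer (der_op_subproof f g).

Lemma qdiv_op (x y z w : A) :
  qdiv (x <* y) (z <* w) = qdiv x z <* qdiv y w.
Proof. by apply: (@qop_inj _ (z <* w)); rewrite qdivK abA !qdivK. Qed.

Lemma der_div_subproof (f g : Der) : is_derivation (fun q => qdiv (f q) (g q)).
Proof.
by move=> q1 q2; rewrite !der_funP qdiv_op (qhom_div (qact_op _)).
Qed.

Definition der_div (f g : Der) : Der := MkDer (der_div_subproof f g).

End Der.

(* Der and Hom may be empty; they are quandles only under the hypothesis ne. *)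
Definition der_quandle (A : actedQuandleType Q')
  (abA : abelian_quandle A) (ne : inhabited (Der A)) : Type := Der A.

Section DerQuandle.
Variables (A : actedQuandleType Q') (abA : abelian_quandle A).
Variable ne : inhabited (Der A).

HB.instance Definition _ := Choice.on (der_quandle abA ne).

Let idem (f : der_quandle abA ne) : der_op abA f f = f.
Proof. by apply: der_eq => q; exact: qop_idem. Qed.

Let divP (f g : der_quandle abA ne) : exists! h, g = der_op abA h f.
Proof.
exists (der_div abA g f); split; first by apply: der_eq => q /=; rewrite qdivK.
by move=> h ->; apply: der_eq => q /=; rewrite qopK.
Qed.

Let distr (f g h : der_quandle abA ne) :
  der_op abA (der_op abA f g) h = der_op abA (der_op abA f h) (der_op abA g h).
Proof. by apply: der_eq => q; exact: qop_distr. Qed.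

HB.instance Definition _ :=
  isQuandle.Build (der_quandle abA ne) idem divP distr ne.

End DerQuandle.

Inductive derived_rel : qterm (As Q' * Q) -> qterm (As Q' * Q) -> Prop :=
| DerivedRel (g : As Q') (q1 q2 : Q) :
    derived_rel (QGen (g, q1 <* q2))
      (QOp (QGen (g, q1)) (QGen (g * as_map phi (as_gen q1), q2))).

Lemma derived_gen_inhabited : inhabited (As Q' * Q).
Proof. by case: (@quandle_inhabited Q) => q; exact: (inhabits (1, q)). Qed.

Definition derived_quandle := pquandle_of derived_rel derived_gen_inhabited.
HB.instance Definition _ := Quandle.on derived_quandle.

Definition derived_gen (x : As Q' * Q) : derived_quandle := pquandle_gen _ _ x.

Lemma derived_genM g q1 q2 : derived_gen (g, q1 <* q2) =
  derived_gen (g, q1) <* derived_gen (g * as_map phi (as_gen q1), q2).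
Proof.
rewrite /derived_gen /pquandle_gen pquandle_piM.
exact/pquandle_eqP/qc_rel.
Qed.

Lemma derived_act_rel (g : As Q') u v : derived_rel u v ->
  qeval (fun x : As Q' * Q => derived_gen (g * x.1, x.2)) u =
  qeval (fun x : As Q' * Q => derived_gen (g * x.1, x.2)) v.
Proof. by case=> h q1 q2 /=; rewrite derived_genM mulgA. Qed.

Definition derived_act (g : As Q') : derived_quandle -> derived_quandle :=
  pquandle_lift (@derived_act_rel g).

Lemma derived_act_gen (g h : As Q') (q : Q) :
  derived_act g (derived_gen (h, q)) = derived_gen (g * h, q).
Proof. exact: pquandle_lift_gen. Qed.

Let actM g : {morph derived_act g : a b / a <* b}.
Proof. exact: pquandle_liftM. Qed.

Let act1 a : derived_act 1 a = a.
Proof.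
apply: (@pquandle_hom_ext _ _ _ derived_gen_inhabited (derived_act 1) id) => //.
move=> [h q].
by rewrite derived_act_gen mul1g.
Qed.

Let act_comp g h a : derived_act (g * h) a = derived_act g (derived_act h a).
Proof.
apply: (@pquandle_hom_ext _ _ _ derived_gen_inhabited _
          (derived_act g \o derived_act h)) => //.
  by move=> b c /=; rewrite !actM.
by move=> [k q]; rewrite /= !derived_act_gen mulgA.
Qed.

HB.instance Definition _ :=
  isActedQuandle.Build Q' derived_quandle act1 act_comp actM.

Lemma qact_derived_gen (g h : As Q') (q : Q) :
  qact g (derived_gen (h, q)) = derived_gen (g * h, q).
Proof. exact: derived_act_gen. Qed.

Section Hom.
Variable A : actedQuandleType Q'.
Local Notation Hom := (acted_hom derived_quandle A).

HB.instance Definition _ := gen_eqMixin Hom.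
HB.instance Definition _ := gen_choiceMixin Hom.

Lemma derived_hom_eq (f g : Hom) :
  (forall x, f (derived_gen x) = g (derived_gen x)) -> f = g.
Proof.
move=> fg; apply: acted_hom_eq.
apply: (@pquandle_hom_ext _ _ _ derived_gen_inhabited f g).
- exact: (acted_homM f).
- exact: (acted_homM g).
- exact: fg.
Qed.

Lemma derived_homE (f : Hom) g q :
  f (derived_gen (g, q)) = qact g (f (derived_gen (1, q))).
Proof. by rewrite -acted_homJ qact_derived_gen mulg1. Qed.

(* A map given on generators by b, compatible with the relations and with the
   actions, extends to a homomorphism of acted quandles. *)
Section Extend.
Variable b : As Q' * Q -> A.
Hypothesis bM : forall g q1 q2, b (g, q1 <* q2) =
  b (g, q1) <* b (g * as_map phi (as_gen q1), q2).
Hypothesis bJ : forall g h q, b (g * h, q) = qact g (b (h, q)).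

Lemma derived_extend_rel u v : derived_rel u v -> qeval b u = qeval b v.
Proof. by case=> g q1 q2; exact: bM. Qed.

Definition derived_extend_fun : derived_quandle -> A :=
  pquandle_lift derived_extend_rel.

Lemma derived_extendM : {morph derived_extend_fun : x y / x <* y}.
Proof. exact: pquandle_liftM. Qed.

Lemma derived_extendJ g x :
  derived_extend_fun (qact g x) = qact g (derived_extend_fun x).
Proof.
apply: (@pquandle_hom_ext _ _ _ derived_gen_inhabited
          (derived_extend_fun \o qact g) (qact g \o derived_extend_fun)).
- by move=> y z /=; rewrite qact_op derived_extendM.
- by move=> y z /=; rewrite derived_extendM qact_op.
move=> [h q] /=; rewrite -[pquandle_gen _ _ _]/(derived_gen (h, q)).
by rewrite qact_derived_gen /derived_extend_fun !pquandle_lift_gen bJ.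
Qed.

Definition derived_extend : Hom := ActedHom derived_extendM derived_extendJ.

Lemma derived_extend_gen x : derived_extend (derived_gen x) = b x.
Proof. exact: pquandle_lift_gen. Qed.

End Extend.

Hypothesis abA : abelian_quandle A.

Section HomOp.
Variables f1 f2 : Hom.

Let op_gen x := f1 (derived_gen x) <* f2 (derived_gen x).

Lemma hom_op_genM g q1 q2 : op_gen (g, q1 <* q2) =
  op_gen (g, q1) <* op_gen (g * as_map phi (as_gen q1), q2).
Proof. by rewrite /op_gen derived_genM !acted_homM abA. Qed.

Lemma hom_op_genJ g h q : op_gen (g * h, q) = qact g (op_gen (h, q)).
Proof. by rewrite /op_gen qact_op -!acted_homJ qact_derived_gen. Qed.

Definition hom_op : Hom := derived_extend hom_op_genM hom_op_genJ.

Lemma hom_op_gen x :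
  hom_op (derived_gen x) = f1 (derived_gen x) <* f2 (derived_gen x).
Proof. exact: derived_extend_gen. Qed.

Let div_gen x := qdiv (f1 (derived_gen x)) (f2 (derived_gen x)).

Lemma hom_div_genM g q1 q2 : div_gen (g, q1 <* q2) =
  div_gen (g, q1) <* div_gen (g * as_map phi (as_gen q1), q2).
Proof. by rewrite /div_gen derived_genM !acted_homM qdiv_op. Qed.

Lemma hom_div_genJ g h q : div_gen (g * h, q) = qact g (div_gen (h, q)).
Proof.
rewrite /div_gen (qhom_div (qact_op g)) -!acted_homJ.
by rewrite qact_derived_gen.
Qed.

Definition hom_div : Hom := derived_extend hom_div_genM hom_div_genJ.

Lemma hom_div_gen x :
  hom_div (derived_gen x) = qdiv (f1 (derived_gen x)) (f2 (derived_gen x)).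
Proof. exact: derived_extend_gen. Qed.

End HomOp.

End Hom.

Definition hom_quandle (A : actedQuandleType Q') (abA : abelian_quandle A)
  (ne : inhabited (acted_hom derived_quandle A)) : Type :=
  acted_hom derived_quandle A.

Section HomQuandle.
Variables (A : actedQuandleType Q') (abA : abelian_quandle A).
Variable ne : inhabited (acted_hom derived_quandle A).

HB.instance Definition _ := Choice.on (hom_quandle abA ne).

Let idem (f : hom_quandle abA ne) : hom_op abA f f = f.
Proof. by apply: derived_hom_eq => x; rewrite hom_op_gen qop_idem. Qed.

Let divP (f g : hom_quandle abA ne) : exists! h, g = hom_op abA h f.
Proof.
exists (hom_div abA g f); split.
  by apply: derived_hom_eq => x; rewrite hom_op_gen hom_div_gen qdivK.
by move=> h ->; apply: derived_hom_eq => x; rewrite hom_div_gen hom_op_gen qopK.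
Qed.

Let distr (f g h : hom_quandle abA ne) :
  hom_op abA (hom_op abA f g) h = hom_op abA (hom_op abA f h) (hom_op abA g h).
Proof. by apply: derived_hom_eq => x; rewrite !hom_op_gen qop_distr. Qed.

HB.instance Definition _ :=
  isQuandle.Build (hom_quandle abA ne) idem divP distr ne.

End HomQuandle.

End Derivations.

Arguments der_quandle {Q Q'} phi A abA ne.
Arguments hom_quandle {Q Q'} phi A abA ne.

(* Main.v *)
(* Evaluating derivations at the points of Q, or Q'-homomorphisms at the
   generators of the derived quandle, gives a family of quandle homomorphisms
   to A which separates points, so that Der and Hom embed in a power of A.
   Identities such as commutativity and involutarity transfer along such a
   family, and so does flatness, since each element of the group generated by
   the S_p \o S_q is carried by each homomorphism of the family to an element
   of the corresponding group of A. *)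
Require Import Defs.
From HB Require Import structures.
From mathcomp Require Import all_boot boolp.

Set Implicit Arguments.
Unset Strict Implicit.
Unset Printing Implicit Defensive.

Local Open Scope quandle_scope.

(** Supplies the two-sided inverse that [flat_group_inv] asks for in the inverse case of
    [flat_group_transport]. *)
Lemma flat_group_bij (Q : quandleType) (f : Q -> Q) :
  flat_group f -> bijective f.
Proof.
have qtrans_bij (q : Q) : bijective (qtrans q).
  exists (fun p => qdiv p q) => p; first exact: qopK.
  exact: qdivK.
elim=> {f} [p q||f g _ fb _ gb|f g _ _ fK gK].
- exact: bij_comp.
- by exists id.
- exact: bij_comp.
- by exists f.
Qed.

(** As [e] need not be surjective, [f] does not determine [f']; it is built by induction on the word
    expressing [f], replacing each [qtrans p] by [qtrans (e p)]. *)
Lemma flat_group_transport (Q A : quandleType) (e : Q -> A) (f : Q -> Q) :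
  {morph e : p q / p <* q} -> flat_group f ->
  exists2 f' : A -> A, flat_group f' & {morph e : p / f p >-> f' p}.
Proof.
move=> eM; elim=> {f} [p q||f g _ [f' Ff' ef] _ [g' Fg' eg]|f g _ [f' Ff' ef] fK gK].
- exists (qtrans (e p) \o qtrans (e q)); first exact: flat_group_gen.
  by move=> x; rewrite /qtrans /= !eM.
- by exists id => //; exact: flat_group_id.
- exists (f' \o g'); first exact: flat_group_comp.
  by move=> x /=; rewrite ef eg.
- have [g' f'K g'K] := flat_group_bij Ff'.
  exists g'; first exact: flat_group_inv f'K g'K.
  by move=> x; rewrite -{2}(gK x) ef f'K.
Qed.

Section SeparatingFamily.
Variables (I : Type) (Q A : quandleType) (e : I -> Q -> A).
Hypothesis eM : forall i, {morph e i : p q / p <* q}.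
Hypothesis e_inj : forall p q, (forall i, e i p = e i q) -> p = q.

Lemma commutative_separated : commutative_quandle A -> commutative_quandle Q.
Proof. by move=> cA p q; apply: e_inj => i; rewrite !eM. Qed.

Lemma involutary_separated : involutary_quandle A -> involutary_quandle Q.
Proof.
move=> iA q; apply/funext => p; apply: e_inj => i; rewrite /qtrans /= !eM.
exact: (congr1 (fun h => h (e i p)) (iA (e i q))).
Qed.

Lemma flat_separated : flat_quandle A -> flat_quandle Q.
Proof.
move=> fA f g Ff Fg; apply/funext => p; apply: e_inj => i.
(* The maps [f'] and [g'] may depend on [i], which is harmless: equality is tested at one [i] at a
   time. *)
have [f' Ff' ef] := flat_group_transport (eM i) Ff.
have [g' Fg' eg] := flat_group_transport (eM i) Fg.
rewrite /= ef eg eg ef.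
exact: (congr1 (fun h => h (e i p)) (fA _ _ Ff' Fg')).
Qed.

End SeparatingFamily.

Theorem proposition4p5 (Q Q' : quandleType) (phi : quandle_hom Q Q')
    (A : actedQuandleType Q') (abA : abelian_quandle A) :
  (commutative_quandle A ->
     (forall ne : inhabited (Der phi A),
        commutative_quandle (der_quandle phi A abA ne)) /\
     (forall ne : inhabited (acted_hom (derived_quandle phi) A),
        commutative_quandle (hom_quandle phi A abA ne))) /\
  (involutary_quandle A ->
     (forall ne : inhabited (Der phi A),
        involutary_quandle (der_quandle phi A abA ne)) /\
     (forall ne : inhabited (acted_hom (derived_quandle phi) A),
        involutary_quandle (hom_quandle phi A abA ne))) /\
  (flat_quandle A ->
     (forall ne : inhabited (Der phi A),
        flat_quandle (der_quandle phi A abA ne)) /\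
     (forall ne : inhabited (acted_hom (derived_quandle phi) A),
        flat_quandle (hom_quandle phi A abA ne))).
Proof.
pose ed ne (q : Q) (d : der_quandle phi A abA ne) : A := der_fun d q.
have edM ne q : {morph @ed ne q : c d / c <* d} by [].
have ed_inj ne c d : (forall q, @ed ne q c = ed ne q d) -> c = d.
  exact: der_eq.
(* Unlike [der_op], which is pointwise by definition, [hom_op] is an extension from generators, so
   evaluation is taken only there. *)
pose eh ne x (f : hom_quandle phi A abA ne) : A :=
  acted_hom_fun f (derived_gen phi x).
have ehM ne x : {morph @eh ne x : f g / f <* g}.
  by move=> f g; exact: hom_op_gen.
have eh_inj ne f g : (forall x, @eh ne x f = eh ne x g) -> f = g.
  exact: derived_hom_eq.
split=> [cA|]; last split=> [iA|fA]; split=> ne.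
- exact: commutative_separated (@edM ne) (@ed_inj ne) cA.
- exact: commutative_separated (@ehM ne) (@eh_inj ne) cA.
- exact: involutary_separated (@edM ne) (@ed_inj ne) iA.
- exact: involutary_separated (@ehM ne) (@eh_inj ne) iA.
- exact: flat_separated (@edM ne) (@ed_inj ne) fA.
- exact: flat_separated (@ehM ne) (@eh_inj ne) fA.
Qed.
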